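(* Let $\lambda(t)$, $c(t)$ and the initial condition $(x(0),\beta(0))$, with $x(0)\in\mathbb{R}_{\ge0}^{\mathcal E}$, be such that the external inflow functions $\lambda_i$, the capacity functions $c_i$, and the initial outflow histories $z_i$ (on $[-\bar\delta,0)$), $i\in\mathcal E$, are all nonnegative and piecewise constant. Then there exists a unique solution $(x(t),\beta(t))\ge 0$, for all $t\ge0$, to the traffic flow model (described in the context).
   Context: Road network: a finite directed multigraph $\mathcal G=(\mathcal V,\mathcal E)$ without self-loops; $\mathcal E$ is the set of links. $R\in\mathbb{R}_{\ge0}^{\mathcal E\times\mathcal E}$ is the routing matrix: $R_{ji}$ is the fraction of the flow leaving link $j$ that goes to link $i$, with $R_{ji}=0$ if $i$ is not immediately downstream of $j$. $R$ is sub-stochastic: nonnegative entries, all row sums at most $1$, at least one row sum strictly less than $1$. Standing connectivity assumption: (i) for every $i,j\in\mathcal E$ there is a directed path from $i$ to $j$ or from $j$ to $i$; (ii) for every $i\in\mathcal E$, either the $i$-th row sum of $R$ is strictly less than $1$, or there is a directed path (along links with consecutive positive entries of $R$) from $i$ to some link $j$ whose row sum in $R$ is strictly less than $1$. In particular the spectral radius of $R$ is strictly less than $1$. $\delta_{ji}\ge0$ is the travel time from link $j$ to link $i$; $\mathcal E_i:=\{j\in\mathcal E: R_{ji}>0,\ \delta_{ji}=0\}$; $\bar\delta_j:=\max\{\delta_{ji}: i\in\mathcal E,R_{ji}>0\}$; $\bar\delta:=\max_{(j,i):R_{ji}>0}\delta_{ji}$. $\lambda_i,c_i:\mathbb{R}_{\ge0}\to\mathbb{R}_{\ge0}$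 are the external inflow and capacity functions. A function on a bounded interval is piecewise constant if the interval can be partitioned into finitely many contiguous right-open intervals on each of which the function is constant; $\lambda_i,c_i$ are called piecewise constant if this holds on every bounded interval $[0,T]$. Traffic flow model: the state is $(x(t),\beta(t))$ with queue lengths $x(t)$ and past departures $\beta(t):=\{z_j(s): s\in[t-\bar\delta_j,t)\}_{j\in\mathcal E}$. The queue lengths satisfy, for $t\ge0$ (with $x$ absolutely continuous and the equation holding for almost every $t$), $$\dot x_i(t)=\tilde\lambda_i(t)+\sum_{j\in\mathcal E_i}R_{ji}z_j(x(t),t)-z_i(x(t),t),\quad i\in\mathcal E,\qquad \tilde\lambda_i(t):=\lambda_i(t)+\sum_{j\in\mathcal E\setminus\mathcal E_i}R_{ji}z_j(t-\delta_{ji}),$$ where $z_j(s)=z_j(x(s),s)$ for $s\ge 0$, $z_j(s)$ for $s<0$ is given by $\beta(0)$, and for each $t\ge0$ the outflow vector $z(x(t),t)$ is the (unique, $\eta$-independent) solution of: maximize $\eta^Tz$ over $z\in\mathbb{R}^{\mathcal E}$ subject to $z_i\le c_i(t)$ for all $i\in\mathcal E$ and $z_i\le\tilde\lambda_i(t)+\sum_{j\in\mathcal E_i}R_{ji}z_j$ for all $i\in\mathcal I(x(t)):=\{i\in\mathcal E:x_i(t)=0\}$, for any $\eta\in\mathbb{R}_{>0}^{\mathcal E}$. *)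

(* Defs.v *)
From HB Require Import structures.
From mathcomp Require Import all_boot all_order all_algebra.
From mathcomp Require Import all_classical all_reals all_analysis.
Set Implicit Arguments.
Unset Strict Implicit.
Unset Printing Implicit Defensive.
Import Order.TTheory GRing.Theory Num.Theory.
Import numFieldNormedType.Exports.
Local Open Scope classical_set_scope.
Local Open Scope ring_scope.

Record multigraph := Multigraph {
  node : finType;
  link : finType;
  tail : link -> node;
  head : link -> node;
  tail_neq_head : forall e, tail e != head e }.

Definition downstream (G : multigraph) : rel (link G) :=
  fun j i => head j == tail i.

Section Network.
Context {K : realType} {G : multigraph}.
Local Notation E := (link G).
Implicit Types (R delta : E -> E -> K) (lambda c x z : E -> K -> K).

Definition row_sum R (j : E) : K := \sum_i R j i.

Definition sub_stochastic R : Prop :=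
  [/\ forall j i, 0 <= R j i,
      forall j, row_sum R j <= 1
    & exists j, row_sum R j < 1].

Definition routing_matrix R : Prop :=
  sub_stochastic R /\ forall j i, ~~ downstream j i -> R j i = 0.

Definition connectivity R : Prop :=
  (forall i j : E,
      connect (@downstream G) i j \/ connect (@downstream G) j i) /\
  (forall i : E, row_sum R i < 1 \/
      exists2 j, connect [rel a b | 0 < R a b] i j & row_sum R j < 1).

(* Travel times are nonnegative, so the default value 0 only matters for a
   maximum over the empty set. *)
Definition max_delay_from R delta (j : E) : K :=
  \big[Num.max/0]_(i | 0 < R j i) delta j i.

Definition max_delay R delta : K :=
  \big[Num.max/0]_(p : E * E | 0 < R p.1 p.2) delta p.1 p.2.

Definition undelayed R delta (i : E) : {set E} :=
  [set j | (0 < R j i) && (delta j i == 0)].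

(* A departure profile [z] gives [z j s] both for s < 0 (initial history) and
   for s >= 0.  The past departures at time [t] are its restriction to
   [t - max_delay_from j, t[ for each [j], padded with 0 outside this window so
   that equality of past departures is equality on the windows. *)
Definition past_departures R delta z (t : K) : E -> K -> K :=
  fun j => patch (fun=> 0) `[t - max_delay_from R delta j, t[ (z j).

Definition state R delta x z (t : K) : (E -> K) * (E -> K -> K) :=
  (x^~ t, past_departures R delta z t).

Definition total_inflow R delta lambda z (i : E) (t : K) : K :=
  lambda i t +
  \sum_(j in ~: undelayed R delta i) R j i * z j (t - delta j i).

(* [lt] stands for the values of [total_inflow], [ct] for the capacities and
   [q] for the queue lengths at a given time. *)
Definition feasible R delta (lt ct q w : E -> K) : Prop :=
  (forall i, w i <= ct i) /\
  (forall i, q i = 0 ->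
     w i <= lt i + \sum_(j in undelayed R delta i) R j i * w j).

Definition optimal_outflow R delta (lt ct q w : E -> K) : Prop :=
  forall eta : E -> K, (forall i, 0 < eta i) ->
    feasible R delta lt ct q w /\
    forall v, feasible R delta lt ct q v ->
      \sum_i eta i * v i <= \sum_i eta i * w i.

(* The intervals are non-overlapping: their interiors are disjoint. *)
Definition absolutely_continuous_on (a b : K) (f : K -> K) : Prop :=
  forall e : K, 0 < e -> exists2 d : K, 0 < d &
    forall (n : nat) (u v : 'I_n -> K),
      (forall k, [/\ a <= u k, u k <= v k & v k <= b]) ->
      trivIset setT (fun k => `]u k, v k[%classic) ->
      \sum_k (v k - u k) < d ->
      \sum_k `|f (v k) - f (u k)| < e.

(* On [a, b[; if s = [:: s_1; ..; s_n] then the breakpoints are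
   a < s_1 < ... < s_n = b (and s is empty when a = b). *)
Definition piecewise_constant (a b : K) (f : K -> K) : Prop :=
  exists2 s : seq K, itv_partition a b s &
    forall k, (k < size s)%N ->
      {in `[nth b (a :: s) k, nth b s k[ &, forall u v, f u = f v}.

Record traffic_flow_solution R delta lambda c (x0 : E -> K) (z0 : E -> K -> K)
    x z : Prop := TrafficFlowSolution {
  initial_state : state R delta x z 0 = (x0, past_departures R delta z0 0);
  queue_abs_cont : forall (i : E) (T : K), 0 <= T ->
    absolutely_continuous_on 0 T (x i);
  queue_ode : forall i : E,
    {ae @lebesgue_measure K, forall t : K, 0 <= t ->
       is_derive t 1 (x i)
         (total_inflow R delta lambda z i t +
          \sum_(j in undelayed R delta i) R j i * z j t - z i t)};
  outflow_lp : forall t : K, 0 <= t ->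
    optimal_outflow R delta ((total_inflow R delta lambda z)^~ t)
      (c^~ t) (x^~ t) (z^~ t) }.

End Network.

(* Main.v *)
Require Import Defs.
From mathcomp Require Import all_boot all_order all_algebra.
From mathcomp Require Import all_classical all_reals all_analysis.
From mathcomp Require Import measurable_realfun ring lra.
Import Order.TTheory GRing.Theory Num.Theory.
Import numFieldNormedType.Exports.
Local Open Scope classical_set_scope.
Local Open Scope ring_scope.
Set Implicit Arguments.
Unset Strict Implicit.
Unset Printing Implicit Defensive.

(** At a fixed time the feasible outflows are closed under coordinatewise
maximum, because raising the outflow of one link only relaxes the inflow
constraints of the others ([feasible_max]).  So the optimum is the same for
all weights: it is the greatest feasible point.  It discharges a nonempty
queue at capacity ([optimal_queued]) and an empty one at the smaller of
capacity and inflow ([optimal_empty]).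

Uniqueness.  Compare two solutions that receive the same external and delayed
inflow.  On a link where the first queue is longer, the first solution
discharges at capacity, hence at least as fast as the second; on a link where
the queues are equal, the difference in inflow splits into a part that leaves
and a part that stays, of the same sign.  In all cases |x_i - x'_i| grows at
most at the rate by which the gap in outflow entering link i exceeds the gap
leaving it, and these rates sum to at most 0 since the rows of R sum to at most
1 ([net_flow_gap_longer], [net_flow_gap_equal], [sum_gap_rate_le0]).  The
sum of the |x_i - x'_i| is absolutely continuous, so a growth estimate at
almost every time is enough for it to be nonincreasing
([ae_nonincreasing_le]).  Equal queues give equal outflows, and as the nonzero
travel times have a positive lower bound, agreement spreads over all times in
steps of that length ([weak_solution_unique]).

Existence.  The outflow that is constructed is constant on a short interval to
the right of every time; queues are affine there.  Such a flow up to time T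
can be prolonged ([flow_extend]): the delayed inflow is constant right after T,
and if the optimum at time T is kept, each empty queue either stays empty or
grows.  A queue that grows was not limited by its inflow, so the constraint
that it loses was not binding and the outflow remains optimal
([optimal_persist]).  Switching times could a priori accumulate from the left
at a time T; but the queues move at bounded speed, so they have limits at T and
the flow up to all times before T is a flow up to T ([flow_closure]).  Flows up
to different times agree by uniqueness and can be glued ([flow_glue]), and
induction along the time axis gives a flow for all times
([flow_exists_forever]).  Finally, a function that is affine to the right of
each point is differentiable outside a countable set ([right_affine_derive]),
which gives the differential equation almost everywhere. *)

(** * The outflow program at a fixed time *)

Section OutflowProgram.
Context {K : realType} {G : multigraph} {R delta : link G -> link G -> K}.
Context (R_ge0 : forall j i, 0 <= R j i).
Local Notation E := (link G).
Implicit Types (lt ct q w v : E -> K) (i j : E).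

Definition link_inflow lt w i : K :=
  lt i + \sum_(j in undelayed R delta i) R j i * w j.

Lemma link_inflow_le lt w v i :
  (forall j, w j <= v j) -> link_inflow lt w i <= link_inflow lt v i.
Proof.
by move=> wv; rewrite lerD2l; apply: ler_sum => j _; rewrite ler_wpM2l.
Qed.

(** Raising any w j only raises the right-hand sides of the inflow constraints,
by [link_inflow_le], while each coordinate of the maximum satisfies its own
constraint because w or v does. *)
Lemma feasible_max lt ct q w v :
  feasible R delta lt ct q w -> feasible R delta lt ct q v ->
  feasible R delta lt ct q (fun i => Num.max (w i) (v i)).
Proof.
move=> [wc wq] [vc vq]; split=> [i|i qi]; rewrite ge_max.
  by rewrite wc vc.
apply/andP; split; [apply: le_trans (wq i qi) _|apply: le_trans (vq i qi) _];
  by apply: link_inflow_le => j; rewrite le_max lexx ?orbT.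
Qed.

Lemma optimal_feasible lt ct q w :
  optimal_outflow R delta lt ct q w -> feasible R delta lt ct q w.
Proof. by move=> /(_ (fun=> 1) (fun=> ltr01)) []. Qed.

(** Since the maximum of w and v is feasible, its sum is at most that of w;
but it dominates w, so it equals w. *)
Lemma optimal_greatest lt ct q w v :
  optimal_outflow R delta lt ct q w -> feasible R delta lt ct q v ->
  forall i, v i <= w i.
Proof.
move=> wopt vf i.
have [wf /(_ _ (feasible_max wf vf))] := wopt (fun=> 1) (fun=> ltr01).
under eq_bigr do rewrite mul1r.
under [leRHS]eq_bigr do rewrite mul1r.
have le_wmax j : true -> w j <= Num.max (w j) (v j) by rewrite le_max lexx.
move=> max_le; have := leif_sum (fun j p => leif_eq (le_wmax j p)).
move=> /ge_leif; rewrite max_le => /esym/forallP /(_ i) /eqP ->.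
by rewrite le_max lexx orbT.
Qed.

Lemma greatest_optimal lt ct q w : feasible R delta lt ct q w ->
  (forall v, feasible R delta lt ct q v -> forall i, v i <= w i) ->
  optimal_outflow R delta lt ct q w.
Proof.
move=> wf wmax eta eta_gt0; split=> // v vf.
by apply: ler_sum => i _; rewrite ler_wpM2l ?wmax ?ltW ?eta_gt0.
Qed.

Lemma optimal_outflow_unique lt ct q w v :
  optimal_outflow R delta lt ct q w -> optimal_outflow R delta lt ct q v ->
  forall i, w i = v i.
Proof.
move=> wopt vopt i; apply/le_anti.
by rewrite !(optimal_greatest wopt, optimal_greatest vopt) //;
  exact: optimal_feasible.
Qed.

(** Coordinatewise supremum of all feasible points; it is feasible because the
inflow constraints are monotone in the outflow, and 0 is feasible. *)
Lemma optimal_outflow_exists lt ct q :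
  (forall i, 0 <= lt i) -> (forall i, 0 <= ct i) ->
  exists2 w, optimal_outflow R delta lt ct q w & forall i, 0 <= w i.
Proof.
move=> lt_ge0 ct_ge0.
have feas0 : feasible R delta lt ct q (fun=> 0).
  split=> // i _; rewrite (le_trans (lt_ge0 i)) // lerDl.
  by apply: sumr_ge0 => j _; rewrite mulr0.
pose S i := [set v i | v in feasible R delta lt ct q]%classic.
have S0 i : S i 0 by exists (fun=> 0).
have ubS i : ubound (S i) (ct i) by move=> _ [v [vc _] <-].
have le_sup v i : feasible R delta lt ct q v -> v i <= sup (S i).
  by move=> vf; apply: ub_le_sup; [exists (ct i)|exists v].
exists (fun i => sup (S i)); last by move=> i; exact: le_sup feas0.
apply: greatest_optimal => [|v vf i]; last exact: le_sup.
split=> [i|i qi]; apply: ge_sup; try by exists 0.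
- exact: ubS.
- move=> _ [v vf <-]; apply: le_trans (vf.2 i qi) _.
  by apply: link_inflow_le => j; exact: le_sup.
Qed.

(** Raising the coordinate of one link relaxes the constraints of all others, so
a value that link i itself can carry cannot exceed the optimum. *)
Lemma optimal_raise lt ct q w i a :
  optimal_outflow R delta lt ct q w -> a <= ct i ->
  (q i = 0 -> a <= link_inflow lt w i) -> a <= w i.
Proof.
move=> wopt ac aq; have [wc wq] := optimal_feasible wopt.
rewrite leNgt; apply/negP => wa.
pose v j := if j == i then a else w j.
have wv j : w j <= v j by rewrite /v; case: eqP => // ->; exact: ltW.
suff vf : feasible R delta lt ct q v.
  by have := optimal_greatest wopt vf i; rewrite /v eqxx leNgt wa.
split=> [j|j qj]; first by rewrite /v; case: eqP => [->//|_].
apply: le_trans (link_inflow_le lt j wv); rewrite /v.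
by case: eqP => [ji|_]; [rewrite ji in qj *; exact: aq|exact: wq].
Qed.

Lemma optimal_queued lt ct q w i :
  optimal_outflow R delta lt ct q w -> q i != 0 -> w i = ct i.
Proof.
move=> wopt /eqP qi; apply/le_anti; rewrite (optimal_feasible wopt).1 /=.
by apply: (optimal_raise wopt).
Qed.

Lemma optimal_empty lt ct q w i :
  optimal_outflow R delta lt ct q w -> q i = 0 ->
  w i = Num.min (ct i) (link_inflow lt w i).
Proof.
move=> wopt qi; have [wc wq] := optimal_feasible wopt.
apply/le_anti; rewrite le_min wc (wq i qi : _ <= link_inflow _ _ _) /=.
by apply: (optimal_raise wopt) => [|_]; rewrite ge_min lexx ?orbT.
Qed.

(** The new queues keep only the inflow constraints that are binding at w.
Let v be feasible for them and u the maximum of w and v.  A link that lost its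
constraint was discharging at capacity below its inflow, so
[u j <= ct j = w j <= link_inflow lt w j <= link_inflow lt u j]: thus u is
feasible for the old constraints as well, and is bounded by w. *)
Lemma optimal_persist lt ct q q' w : optimal_outflow R delta lt ct q w ->
  (forall i, q' i = 0 <-> q i = 0 /\ w i = link_inflow lt w i) ->
  optimal_outflow R delta lt ct q' w.
Proof.
move=> wopt q'E; have [wc wq] := optimal_feasible wopt.
have wf' : feasible R delta lt ct q' w.
  by split=> // i /q'E [qi _]; exact: wq.
apply: greatest_optimal => // v vf i.
pose u j := Num.max (w j) (v j).
have [uc uq] : feasible R delta lt ct q' u := feasible_max wf' vf.
have wu j : w j <= u j by rewrite le_max lexx.
suff uf : feasible R delta lt ct q u.
  by apply: le_trans (optimal_greatest wopt uf i); rewrite le_max lexx orbT.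
split=> // j qj; have [/uq//|q'j] := eqVneq (q' j) 0.
apply: le_trans (uc j) _; apply: le_trans (link_inflow_le lt j wu).
have := optimal_empty wopt qj; case: leP => [? _ //|_ wj].
by case/eqP: q'j; apply/q'E.
Qed.

(** * The gap between two queue vectors with the same inflow *)

Definition net_flow lt w i : K := link_inflow lt w i - w i.

(** Bound for the growth of the distance between two queues at link i: the
outflow gaps that reach i without delay, minus the outflow gap of i itself. *)
Definition gap_rate w v i : K :=
  \sum_(j in undelayed R delta i) R j i * `|w j - v j| - `|w i - v i|.

Lemma gap_rateC w v i : gap_rate w v i = gap_rate v w i.
Proof. by rewrite /gap_rate distrC; under eq_bigr do rewrite distrC. Qed.

(** Summed over the links, the gap of link j enters with weight at most its row
sum and leaves with weight 1. *)
Lemma sum_gap_rate_le0 w v :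
  (forall j, row_sum R j <= 1) -> \sum_i gap_rate w v i <= 0.
Proof.
move=> R_le1; rewrite /gap_rate big_split sumrN subr_le0 /=.
apply: (@le_trans _ _ (\sum_i \sum_j R j i * `|w j - v j|)).
  apply: ler_sum => i _; rewrite [leRHS](bigID (mem (undelayed R delta i))) /=.
  by rewrite lerDl sumr_ge0 // => j _; rewrite mulr_ge0.
rewrite exchange_big; apply: ler_sum => j _ /=.
by rewrite -mulr_suml ler_piMl // R_le1.
Qed.

Lemma link_inflow_gap lt w v i :
  `|link_inflow lt w i - link_inflow lt v i| <=
  \sum_(j in undelayed R delta i) R j i * `|w j - v j|.
Proof.
rewrite /link_inflow opprD addrACA subrr add0r -sumrB.
apply: le_trans (ler_norm_sum _ _ _) _; apply: ler_sum => j _.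
by rewrite -mulrBr normrM (ger0_norm (R_ge0 _ _)).
Qed.

(** The longer queue is nonempty, so its outflow is the capacity and
[w i - v i] is nonnegative: it contributes with the sign of the gap. *)
Lemma net_flow_gap_longer lt ct q q' w v i :
  optimal_outflow R delta lt ct q w -> optimal_outflow R delta lt ct q' v ->
  0 <= q' i -> q' i < q i ->
  net_flow lt w i - net_flow lt v i <= gap_rate w v i.
Proof.
move=> wopt vopt q'_ge0 lt_q.
have wi : w i = ct i.
  by apply: (optimal_queued wopt); rewrite gt_eqF // (le_lt_trans q'_ge0).
have := (optimal_feasible vopt).1 i; rewrite -wi => vw.
rewrite /gap_rate (@ger0_norm _ (w i - _)) ?subr_ge0 //.
have := link_inflow_gap lt w v i; rewrite ler_norml /net_flow => /andP[_].
by move: (\sum_(_ in _) _) => B ?; lra.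
Qed.

(** If both queues are nonempty both outflows equal the capacity.  If both are
empty, the outflows are the minima of the capacity with inflows a and b; then
the gap between the minima has the sign of a - b and is no larger, so that
what remains of a - b is |a - b| minus the gap. *)
Lemma net_flow_gap_equal lt ct q q' w v i :
  optimal_outflow R delta lt ct q w -> optimal_outflow R delta lt ct q' v ->
  q i = q' i -> `|net_flow lt w i - net_flow lt v i| <= gap_rate w v i.
Proof.
move=> wopt vopt qE; have := link_inflow_gap lt w v i.
rewrite /net_flow /gap_rate; move: (\sum_(_ in _) _) => B.
have [q0|qn0] := eqVneq (q i) 0; last first.
  rewrite (optimal_queued wopt qn0) (optimal_queued vopt) -?qE //.
  by rewrite subrr normr0 subr0 opprB addrA subrK.
have /esym q'0 := etrans (esym q0) qE.
have := optimal_empty wopt q0; have := optimal_empty vopt q'0.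
move: (link_inflow _ w i) (link_inflow _ v i) => a b.
rewrite !ler_norml => -> -> /andP[? ?].
case: (leP (ct i) a) => ?; case: (leP (ct i) b) => ?.
- by rewrite subrr normr0; apply/andP; split; lra.
- rewrite ger0_norm; [by apply/andP; split; lra|lra].
- rewrite ler0_norm; [by apply/andP; split; lra|lra].
- by case: (leP a b) => ?;
    [rewrite ler0_norm; last lra|rewrite ger0_norm; last lra];
    apply/andP; split; lra.
Qed.

End OutflowProgram.

Arguments link_inflow {K G} R delta lt w i.
Arguments net_flow {K G} R delta lt w i.
Arguments gap_rate {K G} R delta w v i.

(** * Absolutely continuous functions that grow slowly almost everywhere *)

Section AbsoluteContinuity.
Context {K : realType}.
Implicit Types (a b t u v e r : K) (f g h : K -> K).

(** Induction along a segment in Cousin's form: near every t the property may be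
carried from any point on the left of t to any point on the right of t. *)
Lemma segment_induction a b (P : K -> Prop) : a <= b -> P a ->
  (forall t, a <= t <= b -> exists2 r : K, 0 < r & forall u v,
     a <= u -> u <= t -> t <= v -> v <= b -> t - r < u -> v < t + r ->
     P u -> P v) ->
  P b.
Proof.
move=> ab Pa step.
pose S := [set t | [/\ a <= t, t <= b & P t]].
have Sa : S a by [].
have ubS : ubound S b by move=> t [].
have supS : has_sup S by split; [exists a | exists b].
have asup : a <= sup S by apply: ub_le_sup => //; exists b.
have supb : sup S <= b by apply: ge_sup => //; exists a.
have [|r r0 stepS] := step (sup S); first by rewrite asup.
have [u [au ub Pu] ltu] := sup_adherent r0 supS.
have leu : u <= sup S by apply: ub_le_sup => //; exists b.
pose v := Num.min b (sup S + r / 2).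
have supv : sup S <= v by rewrite le_min supb /=; lra.
have vb : v <= b by rewrite ge_min lexx.
have Pv : P v.
  apply: (stepS u) => //; rewrite gt_min; apply/orP; right; lra.
have : v <= sup S.
  by apply: ub_le_sup; [exists b | split => //; exact: le_trans asup supv].
by rewrite /v ge_min => /orP[bs|]; [rewrite /v min_l // in Pv; lra | lra].
Qed.

Definition separated (p q : K * K) := p.2 <= q.1.

(** Absolute continuity for lists of successive intervals, which unlike families
indexed by ordinals are easily extended by one interval. *)
Lemma absolutely_continuous_chain a b f e :
  absolutely_continuous_on a b f -> 0 < e ->
  exists2 d : K, 0 < d & forall s : seq (K * K),
    all (fun p => [&& a <= p.1, p.1 <= p.2 & p.2 <= b]) s ->
    pairwise separated s -> \sum_(p <- s) (p.2 - p.1) < d ->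
    \sum_(p <- s) `|f p.2 - f p.1| < e.
Proof.
move=> fac /fac[d d0 fd]; exists d => // s s_in s_sep.
rewrite !(big_nth (0, 0)) !big_mkord => sd.
apply: fd => // [k|i j _ _ [t [/=]]].
  by have /and3P[] := all_nthP (0, 0) s_in k (ltn_ord k).
rewrite !in_itv /= => /andP[lti ilt] /andP[ltj jlt].
apply/val_inj/eqP; move: s_sep => /(pairwiseP (0, 0)) sep.
by apply: contraT; rewrite neq_ltn => /orP[] /sep;
  rewrite /separated => /(_ (ltn_ord _) (ltn_ord _)); lra.
Qed.

(** At almost every t the slope over short intervals that contain t is at most
any positive e.  Such a one-sided condition, unlike a derivative, also makes
sense for sums of absolute values. *)
Definition ae_nonincreasing a b f :=
  {ae @lebesgue_measure K, forall t, a <= t <= b -> forall e, 0 < e ->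
     exists2 r : K, 0 < r & forall u v, a <= u -> u <= t -> t <= v -> v <= b ->
       t - r < u -> v < t + r -> f v - f u <= e * (v - u)}.

Lemma measure_extend (U : set K) l u v : measurable U -> u <= v ->
  `]u, v] `<=` U -> (l%:E <= lebesgue_measure (U `&` `]-oo, u]))%E ->
  ((l + (v - u))%:E <= lebesgue_measure (U `&` `]-oo, v]))%E.
Proof.
move=> mU uv uvU lU.
have muv : (lebesgue_measure `]u, v] = (v - u)%:E)%E.
  rewrite lebesgue_measure_itv /= lte_fin; case: ltP => // vu.
  by rewrite (_ : v = u) ?subrr //; lra.
apply: (@le_trans _ _ (lebesgue_measure (`]u, v] `|` (U `&` `]-oo, u])))).
  rewrite measureU //=.
  - by rewrite EFinD muv addeC; apply: leeD.
  - by apply: measurableI.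
  - apply/seteqP; split=> // t [+ [_]].
    by rewrite /= !in_itv /= => /andP[]; lra.
apply: le_measure; rewrite ?inE.
- by apply: measurableU => //; apply: measurableI.
- by apply: measurableI.
- move=> t [uvt|[Ut]]; last by rewrite /= !in_itv /= => /le_trans ->.
  by split; [exact: uvU | move: uvt; rewrite /= !in_itv /= => /andP[]].
Qed.

(** Cover the exceptional null set by an open set U of measure less than d, with
d given by absolute continuity for e.  Travel from a to b by short intervals:
if the interval is chosen around an exceptional point it lies in U and is
recorded in the list s, otherwise f grows on it by at most e times its length.
The recorded intervals have total length at most the measure of U, so f grows
on them by less than e altogether. *)
Theorem ae_nonincreasing_le a b f : a <= b ->
  absolutely_continuous_on a b f -> ae_nonincreasing a b f -> f b <= f a.
Proof.
move=> ab fac [A [mA A0 badA]].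
suff bound e : 0 < e -> f b <= f a + e * (b - a) + e.
  apply/ler_addgt0Pr => e e0.
  have e0' : 0 < e / (b - a + 1) by rewrite divr_gt0 //; lra.
  apply: le_trans (bound _ e0') _; rewrite -addrA lerD2l.
  by rewrite -{2}[e / _]mulr1 -mulrDr divfK //; lra.
move=> e0; have [d d0 fd] := absolutely_continuous_chain fac e0.
have [|U [oU AU UAd]] := @lebesgue_regularity_outer K A d mA _ d0.
  by rewrite /= A0.
have mU : measurable U by exact: open_measurable.
have Ud : (lebesgue_measure U < d%:E)%E.
  apply: le_lt_trans UAd; rewrite -{1}(setDKU AU).
  apply: le_trans (measureU2 _ _ _) _ => //; first exact: measurableD.
  by rewrite [X in (_ + X)%E]A0 adde0.
pose P t := exists s : seq (K * K),
  [/\ all (fun p => [&& a <= p.1, p.1 <= p.2 & p.2 <= t]) s,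
      pairwise separated s,
      ((\sum_(p <- s) (p.2 - p.1))%:E <= lebesgue_measure (U `&` `]-oo, t]))%E
    & f t - f a <= e * (t - a) + \sum_(p <- s) `|f p.2 - f p.1| ].
suff [s [s_in s_sep s_len fb]] : P b.
  have : ((\sum_(p <- s) (p.2 - p.1))%:E < d%:E)%E.
    apply: le_lt_trans s_len _; apply: le_lt_trans Ud.
    by apply: le_measure => //; rewrite inE //; apply: measurableI.
  by rewrite lte_fin => /(fd s s_in s_sep); lra.
apply: (segment_induction ab).
  by exists [::]; split; rewrite // ?big_nil ?measure_ge0 // !subrr mulr0 addr0.
move=> t t_in; have [At|nAt] := pselect (A t).
- have [r /= r0 rU] := (nbhs_ballP _ _).1 (oU t (AU t At)).
  exists r => // u v au ut tv vb tru vtr [s [s_in s_sep s_len fu]].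
  have uv := le_trans ut tv.
  exists (rcons s (u, v)); split.
  + rewrite all_rcons /= au uv lexx /=; apply: sub_all s_in => p /and3P[-> ->].
    by move=> /le_trans ->.
  + rewrite pairwise_rcons s_sep andbT; apply: sub_all s_in => p /and3P[_ _].
    by [].
  + rewrite big_rcons /=; apply: measure_extend => //.
    move=> y; rewrite /= in_itv /= => /andP[uy yv]; apply: rU.
    by rewrite /ball /= ltr_norml; apply/andP; split; lra.
  + rewrite big_rcons /=; have := ler_norm (f v - f u).
    have e_uv : 0 <= e * (v - u) by rewrite mulr_ge0 ?subr_ge0 // ltW.
    by lra.
- have [r r0 fr] : exists2 r : K, 0 < r & forall u v,
      a <= u -> u <= t -> t <= v -> v <= b -> t - r < u -> v < t + r ->
      f v - f u <= e * (v - u).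
    by apply: contrapT => bad; apply: nAt; apply: badA => /= /(_ t_in e e0).
  exists r => // u v au ut tv vb tru vtr [s [s_in s_sep s_len fu]].
  have uv := le_trans ut tv.
  exists s; split=> //.
  + by apply: sub_all s_in => p /and3P[-> ->] /le_trans ->.
  + apply: le_trans s_len _; apply: le_measure; rewrite ?inE;
      [exact: measurableI | exact: measurableI | apply: setIS].
    by move=> y; rewrite /= !in_itv /= => /le_trans ->.
  + by have := fr u v au ut tv vb tru vtr; lra.
Qed.

Lemma lipschitz_absolutely_continuous a b k f :
  (forall u v, a <= u -> u <= v -> v <= b -> `|f v - f u| <= k * (v - u)) ->
  absolutely_continuous_on a b f.
Proof.
move=> fk e e0; have k0 : 0 < `|k| + 1 by rewrite ltr_wpDl.
exists (e / (`|k| + 1)); first exact: divr_gt0.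
move=> n u v uv _; rewrite ltr_pdivlMr // => uve.
apply: le_lt_trans uve; rewrite mulr_suml; apply: ler_sum => i _.
have [au ui vb] := uv i; apply: le_trans (fk _ _ au ui vb) _.
rewrite mulrC ler_wpM2l ?subr_ge0 //.
by rewrite (le_trans (ler_norm k)) // lerDl.
Qed.

Lemma absolutely_continuous_dominated a b f g h :
  (forall u v, `|h v - h u| <= `|f v - f u| + `|g v - g u|) ->
  absolutely_continuous_on a b f -> absolutely_continuous_on a b g ->
  absolutely_continuous_on a b h.
Proof.
move=> h_le fac gac e e0; have e2 : 0 < e / 2 by rewrite divr_gt0.
have [d d0 fd] := fac _ e2; have [d' d'0 gd] := gac _ e2.
exists (Num.min d d'); first by rewrite lt_min d0.
move=> n u v uv tI; rewrite lt_min => /andP[sd sd'].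
have := ltrD (fd n u v uv tI sd) (gd n u v uv tI sd').
rewrite -splitr -big_split /=; apply: le_lt_trans.
by apply: ler_sum => i _; exact: h_le.
Qed.

Lemma absolutely_continuous_dist a b f g :
  absolutely_continuous_on a b f -> absolutely_continuous_on a b g ->
  absolutely_continuous_on a b (fun t => `|f t - g t|).
Proof.
apply: absolutely_continuous_dominated => u v.
apply: le_trans (ler_dist_dist _ _) _.
have -> : f v - g v - (f u - g u) = f v - f u - (g v - g u) by ring.
exact: ler_normB.
Qed.

Lemma absolutely_continuous_sum (I : finType) a b (F : I -> K -> K) :
  (forall i, absolutely_continuous_on a b (F i)) ->
  absolutely_continuous_on a b (fun t => \sum_i F i t).
Proof.
move=> Fac; rewrite -fct_sumE.
apply: (big_ind (absolutely_continuous_on a b)) => [e e0|f g|//].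
  by exists 1 => // n u v _ _ _; rewrite big1 // => i _; rewrite subrr normr0.
apply: absolutely_continuous_dominated => u v.
by rewrite opprD addrACA ler_normD.
Qed.

Lemma is_derive_near t f d e : is_derive t 1 f d -> 0 < e ->
  \forall y \near t, `|f y - f t - d * (y - t)| <= e * `|y - t|.
Proof.
move=> [fd <-] e0.
have : \forall h \near 0^', `|'D_1 f t - h^-1 *: (f (h *: 1 + t) - f t)| <= e.
  by apply: cvgr_dist_le e0; exact: fd.
rewrite near_withinE => /nbhs_ballP[r /= r0 near0].
apply/nbhs_ballP; exists r => // y ty.
have [->|yt] := eqVneq y t; first by rewrite !subrr mulr0 subrr normr0 mulr0.
have h0 : y - t != 0 by rewrite subr_eq0.
have ht : ball 0 r (y - t) by rewrite -ball_normE /= sub0r normrN distrC.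
have := near0 _ ht h0; rewrite scaler1 subrK => near_y.
have -> : f y - f t - 'D_1 f t * (y - t) =
    ((y - t)^-1 * (f y - f t) - 'D_1 f t) * (y - t) by field.
rewrite normrM; apply: ler_wpM2r => //; rewrite distrC; exact: near_y.
Qed.

(** Near a point where f does not vanish, |f| is f or -f.  At a zero of f
the value of |f| at u is dropped and only the growth on the right of t
counts. *)
Lemma dist_growth f t d k e : is_derive t 1 f d -> 0 < e ->
  (0 < f t -> d <= k) -> (f t < 0 -> - d <= k) -> (f t = 0 -> `|d| <= k) ->
  \forall r \near 0^'+, forall u v, u <= t -> t <= v -> t - r < u ->
     v < t + r -> `|f v| - `|f u| <= (k + e) * (v - u).
Proof.
move=> fd e0 kp kn k0.
have fcont : f @ t --> f t.
  by apply: differentiable_continuous; apply/derivable1_diffP; exact: ex_derive.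
have near_pos : \forall y \near t, 0 < f t -> 0 < f y.
  have [ft|_] := ltP 0 (f t); last by near=> y.
  near=> y => _; near: y; exact: (cvgr_gt _ fcont _ ft).
have near_neg : \forall y \near t, f t < 0 -> f y < 0.
  have [ft|_] := ltP (f t) 0; last by near=> y.
  near=> y => _; near: y; exact: (cvgr_lt _ fcont _ ft).
have [r0 /= r0_gt0 near_t] := (nbhs_ballP _ _).1
  (filterI (is_derive_near fd e0) (filterI near_pos near_neg)).
near=> r => u v ut tv tu vt.
have rr0 : r < r0 by near: r; exact: nbhs_right_lt.
have [|du [pu nu]] := near_t u.
  by rewrite /ball /= ltr_norml; apply/andP; split; lra.
have [|dv [pv nv]] := near_t v.
  by rewrite /ball /= ltr_norml; apply/andP; split; lra.
move: dv du; rewrite (@ger0_norm _ (v - t)) ?subr_ge0 //.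
rewrite (@ler0_norm _ (u - t)) ?subr_le0 //.
rewrite !ler_norml => /andP[dv1 dv2] /andP[du1 du2].
have uv : 0 <= v - u by rewrite subr_ge0 (le_trans ut).
have [ft|ft|ft] := ltgtP (f t) 0.
- rewrite (ltr0_norm (nv ft)) (ltr0_norm (nu ft)).
  by have := ler_wpM2r uv (kn ft); lra.
- rewrite (gtr0_norm (pv ft)) (gtr0_norm (pu ft)).
  by have := ler_wpM2r uv (kp ft); lra.
- have ke : 0 <= k + e.
    by apply: addr_ge0; [exact: le_trans (k0 ft) | exact: ltW].
  have : (k + e) * (v - t) <= (k + e) * (v - u) by rewrite ler_wpM2l //; lra.
  have : `|f v| <= (k + e) * (v - t).
    move: (k0 ft); rewrite !ler_norml => /andP[k1 k2].
    have vt0 : 0 <= v - t by rewrite subr_ge0.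
    have := ler_wpM2r vt0 k1; have := ler_wpM2r vt0 k2.
    by move=> ? ?; apply/andP; split; lra.
  by have := normr_ge0 (f u); lra.
Unshelve. all: by end_near.
Qed.

End AbsoluteContinuity.

(** * Uniqueness of solutions *)

Lemma ae_forall_fin (K : realType) (I : finType) (P : I -> K -> Prop) :
  (forall i, {ae @lebesgue_measure K, forall t, P i t}) ->
  {ae @lebesgue_measure K, forall t, forall i, P i t}.
Proof. by move=> aeP; apply: filter_forall. Qed.

Lemma ae_imply (K : realType) (P Q : K -> Prop) : (forall t, P t -> Q t) ->
  {ae @lebesgue_measure K, forall t, P t} ->
  {ae @lebesgue_measure K, forall t, Q t}.
Proof.
move=> PQ; apply: filterS => //.
exact: (ae_filter_ringOfSetsType (@lebesgue_measure K)).
Qed.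

Section Uniqueness.
Context {K : realType} {G : multigraph} {R delta : link G -> link G -> K}.
Context {lambda c : link G -> K -> K}.
Context (R_ge0 : forall j i, 0 <= R j i).
Context (R_le1 : forall j, row_sum R j <= 1).
Context (delta_ge0 : forall j i, 0 <= delta j i).
Local Notation E := (link G).
Implicit Types (x z : E -> K -> K) (i j : E) (s t T : K).

Lemma delay_le_max_from j i :
  0 < R j i -> delta j i <= max_delay_from R delta j.
Proof. by move=> Rji; apply: le_bigmax_cond. Qed.

Lemma max_delay_from_le j : max_delay_from R delta j <= max_delay R delta.
Proof.
apply: bigmax_le => [|i Rji]; first by rewrite bigmax_ge_id.
exact: (@le_bigmax_cond _ _ _ _ (j, i) (fun p => 0 < R p.1 p.2)
  (fun p => delta p.1 p.2)).
Qed.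

Lemma delay_le_max j i : 0 < R j i -> delta j i <= max_delay R delta.
Proof.
by move=> /delay_le_max_from /le_trans; apply; exact: max_delay_from_le.
Qed.

Lemma min_delay : exists2 d : K, 0 < d &
  forall j i, 0 < R j i -> delta j i != 0 -> d <= delta j i.
Proof.
pose delayed (p : E * E) := (0 < R p.1 p.2) && (delta p.1 p.2 != 0).
exists (\big[Num.min/1]_(p | delayed p) delta p.1 p.2) => [|j i Rji dji].
  by apply: lt_bigmin => // p /andP[_ dp]; rewrite lt_def dp delta_ge0.
apply: (@bigmin_le_cond _ _ _ _ (j, i) delayed (fun p => delta p.1 p.2)).
by rewrite /delayed /= Rji.
Qed.

(** A delayed upstream link j has either positive routing and positive travel
time, or zero routing and then contributes nothing. *)
Lemma eq_total_inflow z z' i s t : lambda i s = lambda i t ->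
  (forall j, 0 < R j i -> delta j i != 0 ->
     z j (s - delta j i) = z' j (t - delta j i)) ->
  total_inflow R delta lambda z i s = total_inflow R delta lambda z' i t.
Proof.
move=> lE zE; rewrite /total_inflow lE; congr (_ + _); apply: eq_bigr => j.
rewrite !inE negb_and -leNgt => Rd.
have [Rji|Rji] := ltP 0 (R j i); last first.
  by rewrite (_ : R j i = 0) ?mul0r //; apply/le_anti; rewrite Rji R_ge0.
by rewrite zE //; move: Rd; rewrite leNgt Rji.
Qed.

Definition agree_until T x z x' z' := forall t, 0 <= t -> t < T ->
  forall i, x i t = x' i t /\ z i t = z' i t.

(** The conditions of a solution on [0, T[ without those on the initial state,
so that the comparison of two solutions also applies to flows that are only
known on a bounded interval. *)
Record weak_solution T x z : Prop := WeakSolution {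
  weak_queue_ge0 : forall i t, 0 <= t -> t < T -> 0 <= x i t;
  weak_abs_cont : forall i t, 0 <= t -> t < T ->
    absolutely_continuous_on 0 t (x i);
  weak_ode : forall i, {ae @lebesgue_measure K, forall t, 0 <= t -> t < T ->
    is_derive t 1 (x i)
      (net_flow R delta ((total_inflow R delta lambda z)^~ t) (z^~ t) i)};
  weak_outflow : forall t, 0 <= t -> t < T ->
    optimal_outflow R delta ((total_inflow R delta lambda z)^~ t)
      (c^~ t) (x^~ t) (z^~ t) }.

(** The distance between the two queue vectors grows at link i at most at rate
[gap_rate], and these rates have a nonpositive sum. *)
Lemma queue_contraction T t x z x' z' :
  weak_solution T x z -> weak_solution T x' z' -> 0 <= t -> t < T ->
  (forall s, 0 <= s -> s <= t -> (total_inflow R delta lambda z)^~ s =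
                                 (total_inflow R delta lambda z')^~ s) ->
  \sum_i `|x i t - x' i t| <= \sum_i `|x i 0 - x' i 0|.
Proof.
move=> xz xz' t0 tT inflowE.
apply: (@ae_nonincreasing_le _ 0 t (fun s => \sum_i `|x i s - x' i s|)) => //.
  apply: absolutely_continuous_sum => i; apply: absolutely_continuous_dist.
    exact: (weak_abs_cont xz).
  exact: (weak_abs_cont xz').
apply: filterS2 (ae_forall_fin (weak_ode xz)) (ae_forall_fin (weak_ode xz')).
  exact: (ae_filter_ringOfSetsType (@lebesgue_measure K)).
move=> s ode ode' /andP[s0 st] e e0.
have sT := le_lt_trans st tT.
pose k i := gap_rate R delta (z^~ s) (z'^~ s) i.
(* The tolerance e is shared between the links; the 1 covers a network without
   links. *)
have e'0 : 0 < e / (#|E|%:R + 1) by rewrite divr_gt0 // ltr_wpDl.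
have [zopt z'opt] := (weak_outflow xz s0 sT, weak_outflow xz' s0 sT).
rewrite -(inflowE s s0 st) in z'opt.
pose grows i r := forall u v, u <= s -> s <= v -> s - r < u -> v < s + r ->
  `|x i v - x' i v| - `|x i u - x' i u| <=
  (k i + e / (#|E|%:R + 1)) * (v - u).
have growth i : \forall r \near 0^'+, grows i r.
  have [dx dx'] := (ode i s0 sT, ode' i s0 sT).
  have xs := weak_queue_ge0 xz i s0 sT.
  have x's := weak_queue_ge0 xz' i s0 sT.
  rewrite -(inflowE s s0 st) in dx'.
  apply: (dist_growth (f := fun y => x i y - x' i y) (is_deriveB dx dx')) => //.
  - rewrite subr_gt0 => x'x.
    exact: (net_flow_gap_longer R_ge0 zopt z'opt).
  - rewrite subr_lt0 opprB /k gap_rateC => xx'.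
    exact: (net_flow_gap_longer R_ge0 z'opt zopt).
  - move/subr0_eq => xx'; exact: (net_flow_gap_equal R_ge0 zopt z'opt).
near (0 : K)^'+ => r.
have rgrowth : forall i, grows i r by near: r; exact: filter_forall.
exists r => [|u v _ us sv _ ru vr]; first by near: r; exact: nbhs_right_gt.
rewrite -sumrB.
apply: (@le_trans _ _ (\sum_i (k i + e / (#|E|%:R + 1)) * (v - u))).
  by apply: ler_sum => i _; exact: rgrowth.
rewrite -mulr_suml ler_wpM2r ?subr_ge0 ?(le_trans us) //.
rewrite big_split /= -[leRHS]add0r lerD //; first exact: sum_gap_rate_le0.
rewrite sumr_const -[leLHS]mulr_natr mulrAC ler_pdivrMr ?ltr_wpDl //.
by rewrite ler_wpM2l ?(ltW e0) // lerDl.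
Unshelve. all: by end_near.
Qed.

(** Up to time (n + 1) * d, where d bounds the positive travel times from below,
the delayed inflow only depends on the outflow before time n * d. *)
Theorem weak_solution_unique T x z x' z' :
  weak_solution T x z -> weak_solution T x' z' ->
  (forall i, x i 0 = x' i 0) ->
  (forall j s, - max_delay_from R delta j <= s -> s < 0 -> z j s = z' j s) ->
  agree_until T x z x' z'.
Proof.
move=> xz xz' x0E histE.
have [d d0 d_le] := min_delay.
suff agree n : agree_until (Num.min T (n%:R * d)) x z x' z'.
  move=> t t0 tT i; have [n tn] : exists n : nat, t < n%:R * d.
    exists (Num.trunc (t / d)).+1; rewrite -ltr_pdivrMr //.
    exact: truncnS_gt.
  by apply: (agree n) => //; rewrite lt_min tT.
elim: n => [|n IH] t t0; first by rewrite lt_min mul0r => /andP[_]; lra.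
rewrite lt_min => /andP[tT tn] i.
have inflowE s : 0 <= s -> s <= t ->
    (total_inflow R delta lambda z)^~ s = (total_inflow R delta lambda z')^~ s.
  move=> s0 st; apply/funext => k; apply: eq_total_inflow => // j Rjk djk.
  have [sd|sd] := ltP (s - delta j k) 0.
    by apply: histE => //; have := delay_le_max_from Rjk; lra.
  have := d_le j k Rjk djk; move: tn; rewrite -natr1 mulrDl mul1r => tn dd.
  by apply: (IH _ sd _ j).2; rewrite lt_min; apply/andP; split; lra.
have xE : x^~ t = x'^~ t.
  have := queue_contraction xz xz' t0 tT inflowE.
  rewrite [leRHS]big1 => [|j _]; last by rewrite x0E subrr normr0.
  move=> sum_le0; apply/funext => j; apply/subr0_eq/normr0_eq0/le_anti.
  rewrite normr_ge0 andbT (le_trans _ sum_le0) // (bigD1 j) //= lerDl.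
  exact: sumr_ge0.
split; first by have := congr1 (fun q => q i) xE.
have := weak_outflow xz' t0 tT; rewrite -inflowE // -xE => z'opt.
exact: optimal_outflow_unique (weak_outflow xz t0 tT) z'opt i.
Qed.

End Uniqueness.

Arguments weak_solution {K G} R delta lambda c T x z.

(** * Functions known to the right of each point *)

Section RightLocal.
Context {K : realType}.
Implicit Types (a b t u v e r T : K) (f g : K -> K).

Lemma near_right_ex t (P : K -> Prop) : (\forall s \near t^'+, P s) ->
  exists2 e : K, 0 < e & forall s, t < s -> s < t + e -> P s.
Proof.
move=> /nbhs_ballP[e /= e0 eP]; exists e => // s ts st; apply: eP => //.
by rewrite /ball /= ltr_norml; apply/andP; split; lra.
Qed.

Lemma near_right_shift t d (P : K -> Prop) :
  (\forall s \near (t - d)^'+, P s) -> \forall s \near t^'+, P (s - d).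
Proof.
by move=> /nbhs_right0P P0; apply/nbhs_right0P; under eq_near do rewrite addrAC.
Qed.

Lemma piecewise_constant_ind b f (P : K -> Prop) : P b ->
  (forall a y, a < y -> {in `[a, y[ &, forall u v, f u = f v} -> P y -> P a) ->
  forall a, piecewise_constant a b f -> P a.
Proof.
move=> Pb step a [s [s_path s_last] fs].
elim: s a s_path s_last fs => [|y s IH] a.
  by move=> _ /= /eqP ->.
move=> /= /andP[ay ys] s_last fs; apply: step ay (fs 0%N _) _ => //.
by apply: IH => // k ks; exact: (fs k.+1 ks).
Qed.

Lemma piecewise_constant_near_right a b f t : piecewise_constant a b f ->
  a <= t -> t < b -> \forall s \near t^'+, f s = f t.
Proof.
move: a; apply: piecewise_constant_ind => [bt tb|a y ay fay IH at_ tb].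
  by have := le_lt_trans bt tb; rewrite ltxx.
have [ty|yt] := ltP t y; last exact: IH.
near=> r; apply: fay; rewrite in_itv /= ?at_ ?ty //; apply/andP; split.
  by apply: (le_trans at_); near: r; exact: nbhs_right_ge.
by near: r; exact: nbhs_right_lt.
Unshelve. all: by end_near.
Qed.

Lemma piecewise_constant_bounded a b f : piecewise_constant a b f ->
  exists M, forall t, a <= t -> t < b -> `|f t| <= M.
Proof.
move: a; apply: piecewise_constant_ind => [|a y ay fay [M fM]].
  by exists 0 => t bt tb; have := le_lt_trans bt tb; rewrite ltxx.
exists (Num.max `|f a| M) => t at_ tb; rewrite le_max.
have [ty|yt] := ltP t y; last by rewrite fM ?orbT.
by rewrite (fay t a) ?lexx // in_itv /= ?at_ ?ty ?lexx ?ay.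
Qed.

(** Each t is followed by the gap ]t, t + e t[; distinct gaps contain distinct
rationals. *)
Lemma countable_right_gaps (N : set K) (e : K -> K) :
  (forall t, N t -> 0 < e t) ->
  (forall t u, N t -> N u -> t < u -> t + e t <= u) -> countable N.
Proof.
move=> e_gt0 gap.
have /choice[q qP] : forall t, exists q : rat,
    N t -> t < ratr q /\ ratr q < t + e t.
  move=> t; have [Nt|Nt] := pselect (N t); last by exists 0 => /Nt.
  have [|q] := @rat_in_itvoo K t (t + e t); first by rewrite ltrDl e_gt0.
  by rewrite in_itv /= => /andP[]; exists q.
have q_lt t u : N t -> N u -> t < u -> ratr (q t) < ratr (q u) :> K.
  move=> Nt Nu tu; have [_ qt] := qP t Nt; have [uq _] := qP u Nu.
  exact: lt_trans (lt_le_trans qt (gap t u Nt Nu tu)) uq.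
apply/countable_injP; exists (pickle \o q) => t u.
rewrite !inE => Nt Nu /= /(pcan_inj pickleK) qE.
by have [/(q_lt _ _ Nt Nu)|/(q_lt _ _ Nu Nt)|//] := ltgtP t u;
  rewrite qE ltxx.
Qed.

(** Let e t be a length on which f is affine to the right of t.  A point t of D
that lies inside ]u, u + e u[ for some u of D has f affine on both sides, with a
slope that must be g t as this is the slope on the right.  The other points of D
are separated by the gaps of [countable_right_gaps]. *)
Lemma right_affine_derive (D : set K) f g :
  (forall t, D t -> \forall s \near t^'+, f s = f t + (s - t) * g t) ->
  {ae @lebesgue_measure K, forall t, D t -> is_derive t 1 f (g t)}.
Proof.
move=> fg.
have /choice[e eP] : forall t, exists e : K, D t -> 0 < e /\
    forall s, t < s -> s < t + e -> f s = f t + (s - t) * g t.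
  move=> t; have [Dt|Dt] := pselect (D t); last by exists 0 => /Dt.
  by have [e e0 ef] := near_right_ex (fg t Dt); exists e.
pose N := [set t | D t /\ forall u, D u -> u < t -> u + e u <= t].
have N_countable : countable N.
  apply: (@countable_right_gaps _ e) => [t [/eP[]]//|t u [Dt _] [_ Nu]].
  exact: Nu.
exists N; split.
- exact: countable_measurable.
- exact: countable_lebesgue_measure0.
move=> t /= ndt; split=> [|u Du ut].
  by apply: contrapT => nDt; apply: ndt => /nDt.
rewrite leNgt; apply/negP => tu; apply: ndt => Dt.
have [_ f_u] := eP u Du.
have gE : g u = g t.
  near t^'+ => s.
  have ts : t < s by near: s; exact: nbhs_right_gt.
  have su : s < u + e u by near: s; exact: nbhs_right_lt.
  have : f s = f t + (s - t) * g t by near: s; exact: fg.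
  rewrite (f_u s (lt_trans ut ts) su) (f_u t ut tu) => eq_s.
  have : (s - t) * (g u - g t) = 0 by lra.
  move/eqP; rewrite mulf_eq0 subr_eq0 (gt_eqF ts) /=.
  by move=> /eqP/subr0_eq.
have near_t : \near t, f u + (t - u) * g u = f t.
  near=> s; rewrite (f_u s) //; near: s.
    exact: lt_nbhsr ut.
  exact: lt_nbhsl tu.
apply: near_eq_is_derive near_t _; rewrite -gE.
apply: is_derive_eq.
by rewrite scaler0 subr0 !add0r mul1r; exact: mulr1.
Unshelve. all: by end_near.
Qed.

(** Adding k * t makes f nondecreasing, so the limit is a supremum. *)
Lemma lipschitz_left_limit T (k : K) f : 0 < T ->
  (forall u t, 0 <= u -> u <= t -> t < T -> `|f t - f u| <= k * (t - u)) ->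
  exists q, forall u, 0 <= u -> u < T -> `|q - f u| <= k * (T - u).
Proof.
move=> T0 fk.
pose S := [set f t + k * t | t in [set t | 0 <= t /\ t < T]].
have S_ub u : 0 <= u -> u < T -> ubound S (f u + k * (T - u) + k * T).
  move=> u0 uT _ [t [t0 tT] <-].
  have k0 : 0 <= k.
    have [half_gt0 half_ltT] : 0 < T / 2 /\ T / 2 < T by split; lra.
    have := le_trans (normr_ge0 _) (fk _ _ (lexx 0) (ltW half_gt0) half_ltT).
    by rewrite subr0 pmulr_lge0.
  have [ut|tu] := leP u t.
    have := fk u t u0 ut tT; rewrite ler_norml => /andP[_ ftu].
    have := ler_wpM2l k0 (ltW tT); lra.
  have := fk t u t0 (ltW tu) uT; rewrite ler_norml => /andP[ftu _].
  have := ler_wpM2l k0 (ltW tT); have := ler_wpM2l k0 (ltW uT); lra.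
exists (sup S - k * T) => u u0 uT.
have Su : S (f u + k * u) by exists u.
have ub : sup S <= f u + k * (T - u) + k * T.
  by apply: ge_sup; [exists (f u + k * u) | exact: S_ub].
have lb : f u + k * u <= sup S.
  by apply: ub_le_sup => //; exists (f u + k * (T - u) + k * T); exact: S_ub.
by rewrite ler_norml; apply/andP; split; lra.
Qed.

(** An inequality whose error term tends to 0 as t increases to T. *)
Lemma le_left_limit T (k : K) a b u : u < T ->
  (forall t, u <= t -> t < T -> a <= b + k * (T - t)) -> a <= b.
Proof.
move=> uT le_ab; apply/ler_addgt0Pr => e e0.
have k0 : 0 < `|k| + 1 by rewrite ltr_wpDl.
have d0 : 0 < e / (`|k| + 1) by exact: divr_gt0.
pose t := Num.max u (T - e / (`|k| + 1)).
have tT : t < T by rewrite gt_max uT /=; lra.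
have ut : u <= t by rewrite le_max lexx.
apply: le_trans (le_ab t ut tT) _; rewrite lerD2l.
apply: (@le_trans _ _ ((`|k| + 1) * (T - t))).
  by rewrite ler_wpM2r ?subr_ge0 ?(ltW tT) // (le_trans (ler_norm k)) ?lerDl.
rewrite mulrC -ler_pdivlMr // lerBlDl -lerBlDr.
by rewrite le_max lexx orbT.
Qed.

End RightLocal.

(** * Construction of a flow *)

Section Existence.
Context {K : realType} {G : multigraph} {R delta : link G -> link G -> K}.
Context {lambda c : link G -> K -> K}.
Context {x0 : link G -> K} {z0 : link G -> K -> K}.
Context (R_ge0 : forall j i, 0 <= R j i).
Context (R_le1 : forall j, row_sum R j <= 1).
Context (delta_ge0 : forall j i, 0 <= delta j i).
Context (lambda_ge0 : forall i (t : K), 0 <= t -> 0 <= lambda i t).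
Context (lambda_pc : forall i (T : K), 0 <= T ->
  piecewise_constant 0 T (lambda i)).
Context (c_ge0 : forall i (t : K), 0 <= t -> 0 <= c i t).
Context (c_pc : forall i (T : K), 0 <= T -> piecewise_constant 0 T (c i)).
Context (x0_ge0 : forall i, 0 <= x0 i).
Context (z0_ge0 : forall i (s : K), - max_delay R delta <= s -> s < 0 ->
  0 <= z0 i s).
Context (z0_pc : forall i, piecewise_constant (- max_delay R delta) 0 (z0 i)).
Local Notation E := (link G).
Local Notation inflow := (total_inflow R delta lambda).
Implicit Types (x z : E -> K -> K) (i j : E) (k s t u T : K).

Definition rate z i t : K :=
  net_flow R delta ((inflow z)^~ t) (z^~ t) i.

(** The clause on the right of each time replaces the differential equation.  It
is stated as a germ, so switching times may accumulate from the left.  The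
Lipschitz clause is what allows a passage to the limit at such a time; it is
relative to any bound k on the rates, so that it survives restriction and
gluing with no constant to choose beforehand.  Queues are specified up to and
including T, outflows only before T. *)
Record flow_until T x z : Prop := FlowUntil {
  flow_history : forall j s, s < 0 -> z j s = z0 j s;
  flow_initial : forall i, x i 0 = x0 i;
  flow_queue_ge0 : forall i t, 0 <= t -> t <= T -> 0 <= x i t;
  flow_outflow_ge0 : forall j t, 0 <= t -> t < T -> 0 <= z j t;
  flow_optimal : forall t, 0 <= t -> t < T ->
    optimal_outflow R delta ((inflow z)^~ t) (c^~ t) (x^~ t) (z^~ t);
  flow_right : forall t, 0 <= t -> t < T -> \forall s \near t^'+,
    (forall j, z j s = z j t) /\
    (forall i, x i s = x i t + (s - t) * rate z i t);
  flow_lipschitz : forall i k u t, 0 <= u -> u <= t -> t <= T ->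
    (forall s, 0 <= s -> s < t -> `|rate z i s| <= k) ->
    `|x i t - x i u| <= k * (t - u) }.

Lemma eq_rate z z' i t :
  (forall j s, s <= t -> z' j s = z j s) -> rate z' i t = rate z i t.
Proof.
move=> zE; rewrite /rate /net_flow /link_inflow.
congr (_ + _ - _); last exact: zE.
  by apply: eq_total_inflow => // j _ _; rewrite zE // gerBl.
by apply: eq_bigr => j _; rewrite zE.
Qed.

Lemma eq_flow_until T x z x' z' :
  0 <= T ->
  (forall i t, 0 <= t -> t <= T -> x' i t = x i t) ->
  (forall j s, s < T -> z' j s = z j s) ->
  flow_until T x z -> flow_until T x' z'.
Proof.
move=> T0 xE zE xz.
have rateE i t : t < T -> rate z' i t = rate z i t.
  by move=> tT; apply: eq_rate => j s st; rewrite zE // (le_lt_trans st).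
split.
- by move=> j s s0; rewrite zE ?(flow_history xz) // (lt_le_trans s0).
- by move=> i; rewrite xE // (flow_initial xz).
- by move=> i t t0 tT; rewrite xE // (flow_queue_ge0 xz).
- by move=> j t t0 tT; rewrite zE // (flow_outflow_ge0 xz).
- move=> t t0 tT.
  have -> : z'^~ t = z^~ t by apply/funext => j; rewrite zE.
  have -> : x'^~ t = x^~ t by apply/funext => i; rewrite xE // ltW.
  rewrite (_ : (inflow z')^~ t = (inflow z)^~ t).
    exact: (flow_optimal xz).
  apply/funext => i; apply: eq_total_inflow => // j _ _.
  by rewrite zE // (le_lt_trans _ tT) // gerBl.
- move=> t t0 tT; near=> s.
  have ts : t < s by near: s; exact: nbhs_right_gt.
  have sT : s < T by near: s; exact: nbhs_right_lt.
  have [zs xs] : (forall j, z j s = z j t) /\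
      (forall i, x i s = x i t + (s - t) * rate z i t).
    by near: s; exact: (flow_right xz).
  split=> [j|i]; first by rewrite !zE.
  by rewrite !xE ?rateE ?(ltW tT) ?(ltW sT) // (le_trans t0) // ltW.
- move=> i k u t u0 ut tT rate_k.
  have [uT t0] := (le_trans ut tT, le_trans u0 ut); rewrite !xE //.
  apply: (flow_lipschitz xz) => // s s0 st.
  by rewrite -rateE ?rate_k // (lt_le_trans st).
Unshelve. all: by end_near.
Qed.

Lemma flow_until_restrict T T' x z :
  T' <= T -> flow_until T x z -> flow_until T' x z.
Proof.
move=> T'T xz; have lt_T t : t < T' -> t < T by move=> /lt_le_trans; exact.
split=> //.
- exact: (flow_history xz).
- exact: (flow_initial xz).
- by move=> i t t0 /le_trans/(_ T'T); exact: (flow_queue_ge0 xz).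
- by move=> j t t0 /lt_T; exact: (flow_outflow_ge0 xz).
- by move=> t t0 /lt_T; exact: (flow_optimal xz).
- by move=> t t0 /lt_T; exact: (flow_right xz).
- move=> i k u t u0 ut /le_trans/(_ T'T); exact: (flow_lipschitz xz).
Qed.

Lemma routed_sum_bound (A : {set E}) (a : E -> K) b i : 0 <= b ->
  (forall j, 0 < R j i -> `|a j| <= b) ->
  `|\sum_(j in A) R j i * a j| <= (\sum_j R j i) * b.
Proof.
move=> b0 ab; apply: le_trans (ler_norm_sum _ _ _) _.
apply: (@le_trans _ _ (\sum_(j in A) R j i * b)).
  apply: ler_sum => j _; rewrite normrM (ger0_norm (R_ge0 _ _)).
  have := R_ge0 j i; rewrite le_eqVlt => /predU1P[<-|Rji].
    by rewrite !mul0r.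
  by rewrite ler_wpM2l ?ab.
rewrite mulr_suml [leRHS](bigID (mem A)) /= lerDl.
by apply: sumr_ge0 => j _; rewrite mulr_ge0.
Qed.

Lemma flow_outflow_bounded T : 0 <= T -> exists2 b, 0 <= b &
  forall x z T', T' <= T -> flow_until T' x z ->
    forall j s, - max_delay R delta <= s -> s < T' -> `|z j s| <= b.
Proof.
move=> T0.
have /choice[bc bcP] i := piecewise_constant_bounded (c_pc i T0).
have /choice[bz bzP] i := piecewise_constant_bounded (z0_pc i).
exists (\sum_i (`|bc i| + `|bz i|)).
  by apply: sumr_ge0 => i _; rewrite addr_ge0.
move=> x z T' T'T xz j s ds sT'.
apply: (@le_trans _ _ (`|bc j| + `|bz j|)); last first.
  by rewrite (bigD1 j) //= lerDl sumr_ge0 // => i _; rewrite addr_ge0.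
have [s0|s0] := ltP s 0.
  rewrite (flow_history xz) // (le_trans (bzP j s ds s0)) //.
  by rewrite (le_trans (ler_norm _)) // lerDr.
rewrite ger0_norm ?(flow_outflow_ge0 xz) //.
apply: le_trans ((optimal_feasible (flow_optimal xz s0 sT')).1 j) _.
apply: le_trans (ler_norm _) _.
apply: le_trans (bcP j s s0 (lt_le_trans sT' T'T)) _.
by rewrite (le_trans (ler_norm _)) // lerDl.
Qed.

(** Outflows are bounded by the capacities and the initial history, whatever the
flow; so the bound is common to all flows up to a time before T. *)
Lemma flow_rate_bounded T i : 0 <= T -> exists k,
  forall x z T', T' <= T -> flow_until T' x z ->
    forall t, 0 <= t -> t < T' -> `|rate z i t| <= k.
Proof.
move=> T0; have [b b0 zb] := flow_outflow_bounded T0.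
have [bl lb] := piecewise_constant_bounded (lambda_pc i T0).
exists (bl + (\sum_j R j i) * b + (\sum_j R j i) * b + b).
move=> x z T' T'T xz t t0 tT'.
have max_delay_ge0 : 0 <= max_delay R delta by exact: bigmax_ge_id.
apply: le_trans (ler_normB _ _) _; apply: lerD; last first.
  by apply: (zb x z T') => //; lra.
apply: le_trans (ler_normD _ _) _; apply: lerD.
  apply: le_trans (ler_normD _ _) _; apply: lerD.
    by apply: lb => //; exact: lt_le_trans T'T.
  apply: routed_sum_bound => // j Rji; apply: (zb x z T') => //.
    by have := delay_le_max (delta := delta) Rji; lra.
  by have := delta_ge0 j i; lra.
by apply: routed_sum_bound => // j _; apply: (zb x z T') => //; lra.
Qed.

Lemma flow_weak T x z : 0 <= T -> flow_until T x z ->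
  weak_solution R delta lambda c T x z.
Proof.
move=> T0 xz; split.
- by move=> i t t0 /ltW; exact: (flow_queue_ge0 xz).
- move=> i t t0 tT; have [k rate_k] := flow_rate_bounded i T0.
  apply: (@lipschitz_absolutely_continuous _ 0 t k) => u v u0 uv vt.
  have vT : v <= T by rewrite (le_trans vt) ?ltW.
  apply: (flow_lipschitz xz) => // s s0 sv.
  by apply: rate_k xz _ _ _ => //; exact: lt_le_trans sv vT.
- move=> i.
  apply: (ae_imply (P := fun t => 0 <= t /\ t < T ->
      is_derive t 1 (x i) (rate z i t))) => [t dx t0 tT|]; first exact: dx.
  apply: right_affine_derive => t [t0 tT].
  by apply: filterS (flow_right xz t0 tT) => s [_ /(_ i)].
- exact: (flow_optimal xz).
Qed.

Lemma flow_unique T T' x z x' z' : 0 <= T -> T <= T' ->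
  flow_until T x z -> flow_until T' x' z' ->
  forall t, t < T -> (0 <= t -> forall i, x i t = x' i t) /\
                     (forall j, z j t = z' j t).
Proof.
move=> T0 TT' xz /(flow_until_restrict TT') xz' t tT.
have histE j s : s < 0 -> z j s = z' j s.
  by move=> s0; rewrite (flow_history xz) ?(flow_history xz').
have [t0|t0] := ltP t 0; first by split=> // j; exact: histE.
have agree : agree_until T x z x' z'.
  apply: (weak_solution_unique R_ge0 R_le1 delta_ge0
    (flow_weak T0 xz) (flow_weak T0 xz')) => [i|j s _ /histE//].
  by rewrite (flow_initial xz) (flow_initial xz').
by split=> [_ i|j]; [case: (agree t t0 tT i)|case: (agree t t0 tT j)].
Qed.

(** Flows up to different times agree where both are defined, so at time t one
may read off the value of the flow chosen for any later time h t. *)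
Lemma flow_glue (D : K -> Prop) :
  (forall t, D t -> 0 <= t) ->
  (forall s t, D t -> 0 <= s -> s <= t -> D s) ->
  (forall t, D t -> exists2 t', t < t' & D t') ->
  (forall t, D t -> exists x z, flow_until t x z) ->
  exists x z, forall t, D t -> flow_until t x z.
Proof.
move=> D_ge0 D_down D_open D_flow.
have /choice[h hP] t : exists t', D t -> t < t' /\ D t'.
  have [Dt|Dt] := pselect (D t); last by exists 0 => /Dt.
  by have [t' tt' Dt'] := D_open t Dt; exists t'.
have /choice[y yP] t : exists y : (E -> K -> K) * (E -> K -> K),
    D t -> flow_until t y.1 y.2.
  have [Dt|Dt] := pselect (D t); last first.
    by exists (fun _ _ => 0, fun _ _ => 0) => /Dt.
  by have [x [z xz]] := D_flow t Dt; exists (x, z).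
have y_flow t : D t -> flow_until (h t) (y (h t)).1 (y (h t)).2.
  by move=> /hP[_]; exact: yP.
have y_agree s t u : D s -> D t -> u < h s -> u < h t ->
    (0 <= u -> forall i, (y (h s)).1 i u = (y (h t)).1 i u) /\
    (forall j, (y (h s)).2 j u = (y (h t)).2 j u).
  move=> Ds Dt us ut.
  have [[_ /D_ge0 hs0] [_ /D_ge0 ht0]] := (hP s Ds, hP t Dt).
  have [st|ts] := leP (h s) (h t).
    exact: (flow_unique hs0 st (y_flow s Ds) (y_flow t Dt)).
  have [ux uz] := flow_unique ht0 (ltW ts) (y_flow t Dt) (y_flow s Ds) ut.
  by split=> [u0 i|j]; [rewrite ux|rewrite uz].
pose x i t := (y (h t)).1 i t.
pose z j t := if t < 0 then z0 j t else (y (h t)).2 j t.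
exists x, z => t Dt; have [th Dht] := hP t Dt.
have t0 := D_ge0 t Dt.
apply: (eq_flow_until t0 _ _ (flow_until_restrict (ltW th) (y_flow t Dt))).
  move=> i s s0 st; have Ds := D_down s t Dt s0 st; have [sh _] := hP s Ds.
  by have [xE _] := y_agree s t s Ds Dt sh (le_lt_trans st th); rewrite /x xE.
move=> j s st; rewrite /z; have [s0|s0] := ltP s 0.
  by rewrite (flow_history (y_flow t Dt)).
have Ds := D_down s t Dt s0 (ltW st); have [sh _] := hP s Ds.
by have [_ ->] := y_agree s t s Ds Dt sh (lt_trans st th).
Qed.

(** The queues have limits at T since their rates are bounded before T.  The
Lipschitz estimate for an arbitrary bound l of the rates passes to the limit. *)
Lemma flow_closure T x z : 0 < T ->
  (forall t, 0 <= t -> t < T -> flow_until t x z) ->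
  exists x', flow_until T x' z.
Proof.
move=> T0 xz; have xz0 := xz 0 (lexx 0) T0.
have between t : t < T -> exists2 t', t < t' & t' < T.
  by move=> tT; exists ((t + T) / 2); lra.
have /choice[k kP] i := flow_rate_bounded i (ltW T0).
have rate_k i t : 0 <= t -> t < T -> `|rate z i t| <= k i.
  move=> t0 tT; have [t' tt' t'T] := between t tT.
  have t'0 : 0 <= t' by rewrite (le_trans t0) // ltW.
  exact: (kP i x z t' (ltW t'T) (xz t' t'0 t'T)).
have /choice[q qP] i : exists q, forall u, 0 <= u -> u < T ->
    `|q - x i u| <= k i * (T - u).
  apply: lipschitz_left_limit => // u t u0 ut tT.
  apply: (flow_lipschitz (xz t (le_trans u0 ut) tT)) => // s s0 st.
  by apply: rate_k => //; exact: lt_trans tT.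
pose x' i t := if t < T then x i t else q i.
have x'E i t : t < T -> x' i t = x i t by rewrite /x' => ->.
have x'T i : x' i T = q i by rewrite /x' ltxx.
have flow_at t : 0 <= t -> t < T -> exists t',
    [/\ t < t', t' < T & flow_until t' x' z].
  move=> t0 tT; have [t' tt' t'T] := between t tT.
  have t'0 : 0 <= t' by rewrite (le_trans t0) // ltW.
  exists t'; split=> //; apply: (eq_flow_until t'0 _ _ (xz t' t'0 t'T)) => //.
  by move=> i s _ st; rewrite x'E // (le_lt_trans st).
exists x'; split.
- exact: (flow_history xz0).
- by move=> i; rewrite x'E // (flow_initial xz0).
- move=> i t t0; rewrite le_eqVlt => /predU1P[->|tT]; last first.
    have [t' [tt' _ x'z]] := flow_at t t0 tT.
    by apply: (flow_queue_ge0 x'z) => //; exact: ltW.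
  rewrite x'T; apply: (@le_left_limit _ T (k i) _ _ 0) => // s s0 sT.
  have := qP i s s0 sT; have := flow_queue_ge0 (xz s s0 sT) i s0 (lexx s).
  by rewrite ler_norml => ? /andP[]; lra.
- move=> j t t0 /(flow_at t t0)[t' [tt' _ x'z]].
  exact: (flow_outflow_ge0 x'z).
- by move=> t t0 /(flow_at t t0)[t' [tt' _ x'z]]; exact: (flow_optimal x'z).
- by move=> t t0 /(flow_at t t0)[t' [tt' _ x'z]]; exact: (flow_right x'z).
- move=> i l u t u0 ut.
  rewrite le_eqVlt => /predU1P[tE rate_l|tT rate_l]; last first.
    have t0 := le_trans u0 ut; have [t' [tt' _ x'z]] := flow_at t t0 tT.
    by apply: (flow_lipschitz x'z) => //; exact: ltW.
  rewrite {}tE in ut rate_l *.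
  move: ut; rewrite le_eqVlt => /predU1P[->|uT].
    by rewrite !subrr normr0 mulr0.
  rewrite x'T x'E //; apply: (@le_left_limit _ T (k i) _ _ u) => // s us sT.
  have s0 := le_trans u0 us.
  have l0 : 0 <= l := le_trans (normr_ge0 _) (rate_l u u0 uT).
  have x_l : `|x i s - x i u| <= l * (s - u).
    apply: (flow_lipschitz (xz s s0 sT)) => // v v0 vs.
    by apply: rate_l => //; exact: lt_trans sT.
  have := ler_distD (x i s) (q i) (x i u); have := qP i s s0 sT.
  have := ler_wpM2l l0 (ltW sT); lra.
Qed.

Lemma flow_inflow_ge0 T x z i : 0 <= T -> flow_until T x z -> 0 <= inflow z i T.
Proof.
move=> T0 xz; rewrite addr_ge0 ?lambda_ge0 //; apply: sumr_ge0 => j.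
rewrite !inE negb_and -leNgt => Rd.
have [Rji|Rji] := ltP 0 (R j i); last first.
  by rewrite (_ : R j i = 0) ?mul0r //; apply/le_anti; rewrite Rji R_ge0.
have dji : 0 < delta j i.
  by rewrite lt_def delta_ge0 andbT; move: Rd; rewrite leNgt Rji.
rewrite mulr_ge0 //; have [s0|s0] := ltP (T - delta j i) 0.
  rewrite (flow_history xz) // z0_ge0 //.
  by have := delay_le_max (delta := delta) Rji; lra.
by apply: (flow_outflow_ge0 xz) => //; lra.
Qed.

Lemma lambda_near_right i t : 0 <= t ->
  \forall s \near t^'+, lambda i s = lambda i t.
Proof.
move=> t0; have t1 : 0 <= t + 1 by rewrite addr_ge0.
by apply: piecewise_constant_near_right (lambda_pc i t1) t0 _; rewrite ltrDl.
Qed.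

Lemma c_near_right i t : 0 <= t -> \forall s \near t^'+, c i s = c i t.
Proof.
move=> t0; have t1 : 0 <= t + 1 by rewrite addr_ge0.
by apply: piecewise_constant_near_right (c_pc i t1) t0 _; rewrite ltrDl.
Qed.

Lemma flow_near_right T x z j t : flow_until T x z ->
  - max_delay R delta <= t -> t < T -> \forall s \near t^'+, z j s = z j t.
Proof.
move=> xz dt tT; have [t0|t0] := ltP t 0.
  have z0s := piecewise_constant_near_right (z0_pc j) dt t0.
  near=> s; have s0 : s < 0 by near: s; exact: nbhs_right_lt.
  by rewrite !(flow_history xz) //; near: s.
by apply: filterS (flow_right xz t0 tT) => s [/(_ j)].
Unshelve. all: by end_near.
Qed.

(** A positive queue stays positive for a short time, and an empty one remains
empty exactly if its rate vanishes. *)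
Lemma affine_near_right a r T : 0 <= a -> (a = 0 -> 0 <= r) ->
  \forall s \near T^'+, 0 <= a + (s - T) * r /\
    (a + (s - T) * r = 0 <-> a = 0 /\ r = 0).
Proof.
rewrite le_eqVlt => /predU1P[<-|a0] r_ge0.
  have {}r_ge0 := r_ge0 erefl; near=> s.
  have Ts : 0 < s - T by rewrite subr_gt0; near: s; exact: nbhs_right_gt.
  rewrite add0r mulr_ge0 ?(ltW Ts) //; split=> //; split=> [/eqP|[_ ->]].
    by rewrite mulf_eq0 (gt_eqF Ts) /= => /eqP.
  by rewrite mulr0.
have r1 : 0 < `|r| + 1 by rewrite ltr_wpDl.
near=> s.
have Ts : 0 < s - T by rewrite subr_gt0; near: s; exact: nbhs_right_gt.
suff pos : 0 < a + (s - T) * r.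
  by split; [exact: ltW|split=> [as0|[aE _]]; lra].
have : s - T < a / (`|r| + 1).
  by near: s; apply: nbhs_right_ltDr; exact: divr_gt0.
rewrite ltr_pdivlMr // => small.
have : (s - T) * (- r) <= (s - T) * `|r|.
  by rewrite ler_wpM2l ?(ltW Ts) // -normrN ler_norm.
by lra.
Unshelve. all: by end_near.
Qed.

(** Keep the outflow w that is optimal at T and let the queues move at the
corresponding rates r.  For a short time the capacities and the inflows keep
their values at T, and the empty queues are those empty at T with zero rate, so
[optimal_persist] applies. *)
Lemma flow_extend T x z : 0 <= T -> flow_until T x z ->
  exists T' x' z', T < T' /\ flow_until T' x' z'.
Proof.
move=> T0 xz.
have [w wopt w_ge0] := @optimal_outflow_exists _ _ R delta R_ge0
  ((inflow z)^~ T) (c^~ T) (x^~ T)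
  (fun i => flow_inflow_ge0 i T0 xz) (fun i => c_ge0 i T0).
pose r i := net_flow R delta ((inflow z)^~ T) w i.
pose z' j s := if s < T then z j s else w j.
pose x' i s := if s <= T then x i s else x i T + (s - T) * r i.
have z'E j s : s < T -> z' j s = z j s by rewrite /z' => ->.
have z'T j s : T <= s -> z' j s = w j by rewrite /z' ltNge => ->.
have x'E i s : s <= T -> x' i s = x i s by rewrite /x' => ->.
have x'T i s : T <= s -> x' i s = x i T + (s - T) * r i.
  rewrite le_eqVlt => /predU1P[<-|Ts].
    by rewrite x'E // subrr mul0r addr0.
  by rewrite /x' leNgt Ts.
have xT_ge0 i : 0 <= x i T by exact: (flow_queue_ge0 xz).
have r_ge0 i : x i T = 0 -> 0 <= r i.
  by move=> xiT; rewrite subr_ge0; exact: ((optimal_feasible wopt).2 i xiT).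
have max_delay_ge0 : 0 <= max_delay R delta by exact: bigmax_ge_id.
have delayed_z j i : 0 < R j i -> delta j i != 0 ->
    \forall s \near T^'+, z' j (s - delta j i) = z j (T - delta j i).
  move=> Rji dji; have d0 : 0 < delta j i by rewrite lt_def dji delta_ge0.
  have dT : T - delta j i < T by rewrite gtrBl.
  apply: (@near_right_shift _ T (delta j i)
    (fun s => z' j s = z j (T - delta j i))).
  have zdT : \forall s \near (T - delta j i)^'+, z j s = z j (T - delta j i).
    apply: (flow_near_right j xz _ dT).
    by have := delay_le_max (delta := delta) Rji; lra.
  near=> s; rewrite z'E; last by near: s; exact: nbhs_right_lt.
  by near: s.
have [e e0 near_T] : exists2 e : K, 0 < e & forall s, T < s -> s < T + e ->
    forall i, [/\ inflow z' i s = inflow z i T, c i s = c i T, 0 <= x' i s &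
      x' i s = 0 <-> x i T = 0 /\ r i = 0].
  apply: near_right_ex; apply: filter_forall => i.
  have near_z : \forall s \near T^'+, forall j, 0 < R j i -> delta j i != 0 ->
      z' j (s - delta j i) = z j (T - delta j i).
    apply: filter_forall => j.
    have [Rji|Rji] := boolP (0 < R j i); last by near=> s.
    have [dji|dji] := boolP (delta j i != 0); last by near=> s.
    by have := delayed_z j i Rji dji; apply: filterS => s.
  have near_x := affine_near_right T (xT_ge0 i) (r_ge0 i).
  near=> s.
  have Ts : T <= s by near: s; exact: nbhs_right_ge.
  have [] : 0 <= x i T + (s - T) * r i /\
      (x i T + (s - T) * r i = 0 <-> x i T = 0 /\ r i = 0) by near: s.
  rewrite -x'T //; split=> //.
    apply: eq_total_inflow => //; first by near: s; exact: lambda_near_right.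
    by near: s.
  by near: s; exact: c_near_right.
have inflow_T i s : T <= s -> s < T + e -> inflow z' i s = inflow z i T.
  rewrite le_eqVlt => /predU1P[<- _|Ts sT]; last by have [] := near_T s Ts sT i.
  apply: eq_total_inflow => // j _ dji.
  by rewrite z'E // gtrBl lt_def dji delta_ge0.
have z'_w s : T <= s -> z'^~ s = w by move=> Ts; apply/funext => j; exact: z'T.
have inflow_lt s : T <= s -> s < T + e -> (inflow z')^~ s = (inflow z)^~ T.
  by move=> Ts sT; apply/funext => i; exact: inflow_T.
have rate_T i s : T <= s -> s < T + e -> rate z' i s = r i.
  by move=> Ts sT; rewrite /rate inflow_lt // z'_w.
have rate_before i s : s < T -> rate z' i s = rate z i s.
  by move=> sT; apply: eq_rate => j u us; rewrite z'E // (le_lt_trans us).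
have xz' : flow_until T x' z'.
  by apply: (eq_flow_until T0 _ _ xz) => // i s _; exact: x'E.
(* The estimates hold on ]T, T + e[, and the queues are needed at the end point
   of the extended interval. *)
exists (T + e / 2), x', z'; split; first lra.
have lt_Te s : s <= T + e / 2 -> s < T + e by lra.
split.
- exact: (flow_history xz').
- exact: (flow_initial xz').
- move=> i t t0 /lt_Te tTe; have [tT|Tt] := leP t T.
    exact: (flow_queue_ge0 xz').
  by have [] := near_T t Tt tTe i.
- move=> j t t0 _; have [tT|Tt] := ltP t T; first exact: (flow_outflow_ge0 xz').
  by rewrite z'T.
- move=> t t0 /ltW/lt_Te tTe; have [tT|Tt] := ltP t T.
    exact: (flow_optimal xz').
  rewrite inflow_lt // z'_w //; move: Tt; rewrite le_eqVlt => /predU1P[<-|Tt].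
    by rewrite (_ : x'^~ T = x^~ T) //; apply/funext => i; rewrite x'E.
  have -> : c^~ t = c^~ T.
    by apply/funext => i; have [] := near_T t Tt tTe i.
  apply: (optimal_persist R_ge0 wopt) => i.
  have [_ _ _ ->] := near_T t Tt tTe i.
  by split=> -[-> E]; split=> //;
    [apply/esym/subr0_eq | rewrite /r /net_flow -E subrr].
- move=> t t0 tTe; have [tT|Tt] := ltP t T; first exact: (flow_right xz').
  near=> s.
  have ts : t < s by near: s; exact: nbhs_right_gt.
  have Ts : T <= s by rewrite (le_trans Tt) // ltW.
  split=> [j|i]; first by rewrite !z'T.
  by rewrite !x'T // rate_T ?lt_Te ?(ltW tTe) //; ring.
- move=> i k u t u0 ut /lt_Te tTe rate_k; have [tT|Tt] := leP t T.
    exact: (flow_lipschitz xz').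
  have r_k : `|r i| <= k by rewrite -(rate_T i T) ?lexx ?ltrDl // rate_k.
  rewrite (x'T i t (ltW Tt)); have [uT|Tu] := leP u T; last first.
    rewrite (x'T i u (ltW Tu)) opprD addrACA subrr add0r -mulrBl.
    have -> : t - T - (u - T) = t - u by ring.
    by rewrite normrM ger0_norm ?subr_ge0 // mulrC ler_wpM2r ?subr_ge0.
  rewrite (x'E i u uT) addrAC; apply: le_trans (ler_normD _ _) _.
  have -> : k * (t - u) = k * (T - u) + k * (t - T) by ring.
  apply: lerD.
    apply: (flow_lipschitz xz) => // s s0 sT; rewrite -rate_before //.
    by apply: rate_k => //; exact: lt_trans Tt.
  rewrite normrM ger0_norm ?subr_ge0 ?(ltW Tt) // mulrC.
  by rewrite ler_wpM2r // subr_ge0 ltW.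
Unshelve. all: by end_near.
Qed.

Lemma flow_start : flow_until 0 (fun i _ => x0 i) z0.
Proof.
have no_time s : 0 <= s -> s < 0 -> False.
  by move=> /le_lt_trans/[apply]; rewrite ltxx.
split=> //; try by move=> ? ? /no_time/[apply].
- by move=> ? /no_time/[apply].
- by move=> ? /no_time/[apply].
- move=> i k u t u0 ut t0 _; have -> : t = u by lra.
  by rewrite !subrr normr0 mulr0.
Qed.

(** Near a time up to which there is a flow, flows extend a little further.
Near a time t without one, flows already fail to exist up to some s < t, by
[flow_closure], so there is nothing to carry across t. *)
Lemma flow_exists T : 0 <= T -> exists x z, flow_until T x z.
Proof.
move=> T0.
apply: (@segment_induction _ 0 T (fun t => exists x z, flow_until t x z)).
- exact: T0.
- by exists (fun i _ => x0 i), z0; exact: flow_start.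
move=> t /andP[t0 tT].
have [[x [z xz]]|no_flow] := pselect (exists x z, flow_until t x z).
  have [T' [x' [z' [tT' xz']]]] := flow_extend t0 xz.
  exists (T' - t); first by rewrite subr_gt0.
  move=> u v _ _ _ _ _; rewrite addrC subrK => /ltW vT' _.
  by exists x', z'; exact: flow_until_restrict xz'.
have [[s [s0 st] no_flow_s]|all_flow] := pselect
    (exists2 s, 0 <= s /\ s < t & ~ exists x z, flow_until s x z).
  exists (t - s); first by rewrite subr_gt0.
  move=> u v _ _ _ _; rewrite opprB addrC subrK => su _ [x [z xz]].
  by case: no_flow_s; exists x, z; exact: flow_until_restrict (ltW su) xz.
have t_gt0 : 0 < t.
  rewrite lt_def t0 andbT; apply/eqP => tE; apply: no_flow.
  by rewrite tE; exists (fun i _ => x0 i), z0; exact: flow_start.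
case: no_flow; have [||||x [z xz]] := @flow_glue (fun s => 0 <= s /\ s < t).
- by move=> s [].
- by move=> s u [_ ut] s0 su; split=> //; exact: le_lt_trans ut.
- by move=> s [s0 st]; exists ((s + t) / 2); [|split]; lra.
- by move=> s st; apply: contrapT => no_flow; apply: all_flow; exists s.
have [|x' x'z] := flow_closure t_gt0 (x := x) (z := z).
  by move=> s s0 st; exact: xz.
by exists x', z.
Qed.

Lemma flow_exists_forever : exists x z, forall t, 0 <= t -> flow_until t x z.
Proof.
apply: flow_glue => //.
- by move=> t t0; exists (t + 1); [rewrite ltrDl | rewrite addr_ge0].
- exact: flow_exists.
Qed.

End Existence.

(** * Existence and uniqueness for the traffic flow model *)

(** Past departures are padded by 0 outside their windows, so equality only
tests the windows. *)
Lemma eq_past_departures (K : realType) (G : multigraph)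
    (R delta : link G -> link G -> K) (z z' : link G -> K -> K) (t : K) :
  past_departures R delta z t = past_departures R delta z' t <->
  (forall j s, t - max_delay_from R delta j <= s -> s < t -> z j s = z' j s).
Proof.
rewrite /past_departures /patch; split=> [zE j s ds st|zE].
  have := congr1 (fun p => p j s) zE.
  by rewrite mem_set //= in_itv /= ds.
apply/funext => j; apply/funext => s; case: ifPn => // /set_mem /=.
by rewrite in_itv /= => /andP[]; exact: zE.
Qed.

Theorem proposition2 (K : realType) (G : multigraph)
    (R delta : link G -> link G -> K) (lambda c : link G -> K -> K)
    (x0 : link G -> K) (z0 : link G -> K -> K)
    (hR : routing_matrix R) (hconn : connectivity R)
    (hdelta : forall j i, 0 <= delta j i)
    (hlambda0 : forall i (t : K), 0 <= t -> 0 <= lambda i t)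
    (hlambda : forall i (T : K), 0 <= T -> piecewise_constant 0 T (lambda i))
    (hc0 : forall i (t : K), 0 <= t -> 0 <= c i t)
    (hc : forall i (T : K), 0 <= T -> piecewise_constant 0 T (c i))
    (hx0 : forall i, 0 <= x0 i)
    (hz0 : forall i (s : K), - max_delay R delta <= s -> s < 0 -> 0 <= z0 i s)
    (hz : forall i, piecewise_constant (- max_delay R delta) 0 (z0 i)) :
  exists x z : link G -> K -> K,
    [/\ traffic_flow_solution R delta lambda c x0 z0 x z,
        forall t : K, 0 <= t ->
          (forall i, 0 <= (state R delta x z t).1 i) /\
          (forall j s, 0 <= (state R delta x z t).2 j s)
      & forall x' z' : link G -> K -> K,
          traffic_flow_solution R delta lambda c x0 z0 x' z' ->
          (forall i (t : K), 0 <= t -> 0 <= x' i t) ->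
          forall t : K, 0 <= t -> state R delta x' z' t = state R delta x z t].
Proof.
have [[R_ge0 R_le1 _] _] := hR.
have [x [z xz]] := flow_exists_forever R_ge0 R_le1 hdelta hlambda0 hlambda
  hc0 hc hx0 hz0 hz.
have lt_succ (t : K) : t < t + 1 by rewrite ltrDl.
have succ_ge0 (t : K) : 0 <= t -> 0 <= t + 1 by move=> ?; rewrite addr_ge0.
have flow_at (t : K) (t0 : 0 <= t) := xz (t + 1) (succ_ge0 t t0).
have weak_at (t : K) (t0 : 0 <= t) :=
  flow_weak R_ge0 hdelta hlambda hc hz (succ_ge0 t t0) (flow_at t t0).
have histE := flow_history (xz 0 (lexx 0)).
exists x, z; split.
- split.
  + congr (_, _).
      by apply/funext => i; exact: flow_initial (xz 0 (lexx 0)) i.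
    by apply/eq_past_departures => j s _; exact: histE.
  + by move=> i t t0; exact: weak_abs_cont (weak_at t t0) i t t0 (lt_succ t).
  + move=> i; apply: (@right_affine_derive K [set t | 0 <= t] (x i)) => t t0.
    by apply: filterS (flow_right (flow_at t t0) t0 (lt_succ t)) => s [_].
  + by move=> t t0; exact: flow_optimal (flow_at t t0) t t0 (lt_succ t).
- move=> t t0; split=> [i|j s].
    exact: flow_queue_ge0 (xz t t0) i t t0 (lexx t).
  rewrite /= /past_departures /patch; case: ifPn => // /set_mem /=.
  rewrite in_itv /= => /andP[ds st]; have [s0|s0] := ltP s 0; last first.
    exact: flow_outflow_ge0 (xz t t0) j s s0 st.
  rewrite histE // hz0 //.
  by have := max_delay_from_le (R := R) (delta := delta) j; lra.
- move=> x' z' xz' x'_ge0 t t0.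
  have x'z_weak : weak_solution R delta lambda c (t + 1) x' z'.
    split=> [i s s0 _|i s s0 _|i|s s0 _].
    + exact: x'_ge0.
    + exact: (queue_abs_cont xz').
    + by apply: ae_imply (queue_ode xz' i) => s dx s0 _; exact: dx.
    + exact: (outflow_lp xz').
  have [x'0 /eq_past_departures z'_hist] := initial_state xz'.
  have {}z'_hist j s :
      - max_delay_from R delta j <= s -> s < 0 -> z' j s = z0 j s.
    by move=> ds; apply: z'_hist; rewrite sub0r.
  have agree := weak_solution_unique R_ge0 R_le1 hdelta x'z_weak (weak_at t t0).
  have {}agree : agree_until (t + 1) x' z' x z.
    apply: agree => [i|j s ds s0]; last by rewrite z'_hist // histE.
    by rewrite (flow_initial (xz 0 (lexx 0))) -x'0.
  congr (_, _); first by apply/funext => i; case: (agree t t0 (lt_succ t) i).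
  apply/eq_past_departures => j s ds st; have [s0|s0] := ltP s 0.
    by rewrite z'_hist ?histE //; lra.
  by case: (agree s s0 (lt_trans st (lt_succ t)) j).
Qed.
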